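(* Let $n$ be a positive integer, let $\alpha\ge 1$ and $\lambda>0$ be real numbers. Then $$\sup_{(x_1,\dots,x_n)\in H_\lambda} F_\alpha(x_1,\dots,x_n) = \max\left(n-1, \frac{n}{(1+\lambda)^\alpha}\right).$$
   Context: For a positive integer $n$, a real number $\alpha$ and a real number $\lambda>0$, define $$F_\alpha(x_1,x_2,\dots,x_n)=\sum_{i=1}^{n}\frac{1}{(1+x_i)^\alpha}$$ and $$H_\lambda=\{(x_1,x_2,\dots,x_n)\in\mathbb{R}^n : x_1x_2\cdots x_n=\lambda^n,\ x_1,x_2,\dots,x_n>0\}.$$ *)

(* Defs.v *)
From mathcomp Require Import all_boot all_order all_algebra.
From mathcomp Require Import all_classical all_reals all_analysis.
Set Implicit Arguments.
Unset Strict Implicit.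
Unset Printing Implicit Defensive.
Import Order.TTheory GRing.Theory Num.Theory.
Local Open Scope classical_set_scope.
Local Open Scope ring_scope.

(* Points of R^n are row vectors, with coordinates [x ord0 i], [i : 'I_n]. *)

Definition Falpha (R : realType) (n : nat) (alpha : R) (x : 'rV[R]_n) : R :=
  \sum_(i < n) 1 / ((1 + x ord0 i) `^ alpha).

Definition Hlambda (R : realType) (n : nat) (lambda : R) : set 'rV[R]_n :=
  [set x : 'rV[R]_n | \prod_(i < n) x ord0 i = lambda ^+ n /\
                     forall i : 'I_n, 0 < x ord0 i].

Arguments Hlambda {R} n lambda _.

(* Main.v *)
Require Import Defs.
From mathcomp Require Import all_boot all_order all_algebra.
From mathcomp Require Import all_classical all_reals all_analysis.
From mathcomp Require Import ring lra.
Set Implicit Arguments.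
Unset Strict Implicit.
Unset Printing Implicit Defensive.
Import Order.TTheory GRing.Theory Num.Theory.
Local Open Scope classical_set_scope.
Local Open Scope ring_scope.

(* Put u_i = (1 + x_i)^(-alpha) and K u = u^(-1/alpha) - 1, so that x_i = K u_i.
   If sum u_i > n - 1, then any two of the u_i have sum at least 1, and in that
   range moving two points towards each other with a fixed sum increases the
   product of their K-values.  Replacing the u_i one at a time by their mean A
   gives lambda^n <= (K A)^n, that is sum u_i <= n / (1 + lambda)^alpha.
   The value n - 1 is approached by letting all coordinates but one tend to 0. *)

(** * The inequality for a pair of values *)

(** Since [s] is the convex combination of [t] and 1 with weight (1 - s)/(1 - t) on [t], convexity
    of x^p puts s^p below the chord; clearing the denominator gives the claim. *)
Lemma powR_chord1 (R : realType) (p s t : R) : 1 <= p -> 0 <= t <= s -> s < 1 ->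
  (1 - s) * (1 - t `^ p) <= (1 - t) * (1 - s `^ p).
Proof.
move=> p1 /andP[t0 ts] s1.
have t1 : 0 < 1 - t by lra.
have d0 : 0 <= (1 - s) / (1 - t) by rewrite divr_ge0 //; lra.
have d1 : (1 - s) / (1 - t) <= 1 by rewrite ler_pdivrMr //; lra.
have : ((1 - s) / (1 - t) * t + (1 - (1 - s) / (1 - t)) * 1) `^ p <=
    (1 - s) / (1 - t) * t `^ p + (1 - (1 - s) / (1 - t)) * 1 `^ p.
  by apply: (convex_powR p1 (Itv01 d0 d1)); rewrite inE /= in_itv /= ?t0 ?ler01.
rewrite powR1.
have -> : (1 - s) / (1 - t) * t + (1 - (1 - s) / (1 - t)) * 1 = s.
  by field; lra.
set x := t `^ p; set y := s `^ p => H.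
rewrite -(@ler_pM2l _ (1 - t)^-1) ?invr_gt0 // !mulrA mulVf ?mul1r; last lra.
rewrite [_^-1 * _]mulrC; lra.
Qed.

(** Provides the sign of a derivative in [powRN_sub1_pair_le]. A comparison of chord slopes is
    combined with a(1 - a) <= b(1 - b). *)
Lemma mul_onem_powR_le (R : realType) (beta a b : R) :
  0 < beta <= 1 -> 0 < b <= a -> a < 1 -> 1 <= a + b ->
  a * (1 - a `^ beta) <= b * (1 - b `^ beta).
Proof.
move=> /andP[be0 be1] /andP[b0 ba] a1 ab.
have a0 : 0 < a by lra.
have o : 1 `^ beta = 1 :> R by rewrite powR1.
have bek : beta * beta^-1 = 1 by rewrite divff // gt_eqF.
(* Chord slopes towards 1 of the concave function t |-> t `^ beta decrease. *)
have key : (1 - a `^ beta) * (1 - b) <= (1 - b `^ beta) * (1 - a).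
  (* Concavity of t^beta is obtained from convexity of its inverse, the power [beta^-1]. *)
  have := @powR_chord1 R beta^-1 (a `^ beta) (b `^ beta).
  rewrite -!powRrM bek (powRr1 (ltW a0)) (powRr1 (ltW b0)); apply.
  - by rewrite invf_ge1.
  - by rewrite powR_ge0 /= ge0_ler_powR ?nnegrE // ltW.
  - by rewrite -[ltRHS]o gt0_ltr_powR ?nnegrE ?ltW.
have bb : 0 <= 1 - b `^ beta.
  rewrite subr_ge0 -[leRHS]o ge0_ler_powR ?nnegrE; lra.
rewrite -(@ler_pM2r _ (1 - b)); last lra.
rewrite -mulrA; apply: le_trans (ler_wpM2l (ltW a0) key) _.
(* The difference b(1 - b) - a(1 - a) factors as (a - b)(a + b - 1); this is where 1 <= a + b
   enters. *)
have : 0 <= (1 - b `^ beta) * ((a - b) * (a + b - 1)).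
  by rewrite !mulr_ge0 // subr_ge0.
by set B := b `^ beta; lra.
Qed.

(** With l + h fixed, the product [P] is symmetric about (l + h)/2 and nondecreasing from [l] up to
    that midpoint. *)
Lemma powRN_sub1_pair_le (R : realType) (beta l m h : R) :
  0 < beta <= 1 -> 0 < l -> l <= m <= h -> h < 1 -> 1 <= l + h ->
  (l `^ (- beta) - 1) * (h `^ (- beta) - 1) <=
  (m `^ (- beta) - 1) * ((l + h - m) `^ (- beta) - 1).
Proof.
move=> be l0 /andP[lm mh] h1 lh.
pose P (x : R) := (x `^ (- beta) - 1) * ((l + h - x) `^ (- beta) - 1).
wlog mhalf : m lm mh / m <= (l + h) / 2.
  move=> W; have [|Hm] := leP m ((l + h) / 2); first exact: W.
  have := W (l + h - m); rewrite subKr [_ * (m `^ _ - 1)]mulrC; apply; lra.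
have -> : h `^ (- beta) = (l + h - l) `^ (- beta) by congr (_ `^ _); ring.
rewrite -/(P l) -/(P m).
have dP x : 0 < x -> 0 < l + h - x -> is_derive x 1 P
    ((- beta * x `^ (- beta - 1)) * ((l + h - x) `^ (- beta) - 1) +
     (x `^ (- beta) - 1) * (beta * (l + h - x) `^ (- beta - 1))).
  move=> x0 y0.
  have D1 : is_derive x 1 (fun x : R => x `^ (- beta) - 1) (- beta * x `^ (- beta - 1)).
    have := is_deriveB (is_derive1_powR (- beta) x0) (is_derive_cst (1 : R) x 1).
    by rewrite subr0.
  have D2 : is_derive x 1 (fun x : R => (l + h - x) `^ (- beta) - 1)
     (beta * (l + h - x) `^ (- beta - 1)).
    have E : is_derive x 1 (fun x : R => l + h - x) (-1).
      have := is_deriveB (is_derive_cst (l + h : R) x 1) (is_derive_id x (1 : R)).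
      by rewrite sub0r.
    have F : is_derive x 1 (fun x : R => (l + h - x) `^ (- beta))
        (- beta * (l + h - x) `^ (- beta - 1) * -1).
      exact: (@is_derive1_comp R (fun y => y `^ (- beta)) (fun x : R => l + h - x)
        x _ _ (is_derive1_powR (- beta) y0) E).
    have := is_deriveB F (is_derive_cst (1 : R) x 1).
    by move=> /is_derive_eq; apply; rewrite subr0 mulrN1 mulNr opprK.
  have := is_deriveM D1 D2.
  move=> /is_derive_eq; apply.
  rewrite addrC; congr (_ + _); first by rewrite [RHS]mulrC.
have c2 : (l + h) / 2 < 1 by lra.
have itv x : x \in `[l, (l + h) / 2] -> [/\ l <= x, x <= (l + h) / 2, 0 < x & 0 < l + h - x].
  by rewrite in_itv /= => /andP[? ?]; split; lra.
apply: (@ger0_derive1_le_cc R P l ((l + h) / 2)) => //.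
- move=> x /subset_itv_oo_cc /itv[? ? x0 y0]; by case: (dP x x0 y0).
- move=> x /subset_itv_oo_cc /itv[xl xh x0 y0].
  have := dP x x0 y0 => D; rewrite derive1E derive_val.
  set y := l + h - x in y0 D *.
  (* Left of the midpoint x <= y < 1, and x + y = l + h >= 1. *)
  have Q : y * (1 - y `^ beta) <= x * (1 - x `^ beta).
    by apply: mul_onem_powR_le => //; rewrite /y; lra.
  have [X0 Y0] : 0 < x `^ beta /\ 0 < y `^ beta by rewrite !powR_gt0.
  have pow z : 0 < z -> z `^ (- beta - 1) = (z `^ beta)^-1 / z.
    by move=> z0; rewrite powRB ?powRr1 ?ltW // ?powRN // (gt_eqF z0) implybT.
  rewrite (pow x x0) (pow y y0) !powRN.
  move: Q X0 Y0; set X := x `^ beta; set Y := y `^ beta => Q X0 Y0.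
  (* The derivative is a positive multiple of the difference bounded in [Q]. *)
  have -> : - beta * (X^-1 / x) * (Y^-1 - 1) + (X^-1 - 1) * (beta * (Y^-1 / y)) =
     beta / (X * Y * x * y) * (x * (1 - X) - y * (1 - Y)).
    by field; rewrite !gt_eqF.
  apply: mulr_ge0; last by rewrite subr_ge0.
  by rewrite divr_ge0 ?mulr_ge0 // ?ltW //; case/andP: be.
- apply: derivable_within_continuous => x /itv[? ? x0 y0]; by case: (dP x x0 y0).
- by rewrite in_itv /= lexx; lra.
- by rewrite in_itv /= lm.
Qed.

(** * Smoothing a list towards its mean *)

Lemma powRN_sub1_gt0 (R : realType) (beta u : R) :
  0 < beta -> 0 < u < 1 -> 0 < u `^ (- beta) - 1.
Proof.
move=> be0 /andP[u0 u1]; rewrite subr_gt0 powRN.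
rewrite invf_gt1 ?powR_gt0 //.
have o : 1 `^ beta = 1 :> R by rewrite powR1.
by rewrite -[ltRHS]o gt0_ltr_powR ?nnegrE ?ltW.
Qed.

Lemma sum_seq_le_size (R : realDomainType) (s : seq R) :
  {in s, forall u, u < 1} -> \sum_(u <- s) u <= (size s)%:R.
Proof.
move=> s1; rewrite -sum1_size natr_sum big_seq [leRHS]big_seq.
by apply: ler_sum => u /s1 /ltW.
Qed.

(** Induction on the length: entries l <= A <= h are traded for [A] and l + h - A, which does not
    lower the product; then [A] is split off, leaving a shorter list with the same mean. *)
Lemma prod_powRN_sub1_le (R : realType) (beta A : R) (s : seq R) :
  0 < beta <= 1 -> {in s, forall u, 0 < u < 1} ->
  \sum_(u <- s) u = (size s)%:R * A -> (size s)%:R - 1 <= \sum_(u <- s) u ->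
  \prod_(u <- s) (u `^ (- beta) - 1) <= (A `^ (- beta) - 1) ^+ size s.
Proof.
move=> be; move: {2}(size s) (erefl (size s)) => n.
elim: n s => [|n IH] s sn sb sA sge.
  by case: s sn {sb sA sge} => // _; rewrite big_nil expr0.
have b0 : 0 < beta by case/andP: be.
have [l ls lA] : exists2 l, l \in s & l <= A.
  apply/hasP; apply: contraT; rewrite -all_predC => /allP H.
  have : (size s)%:R * A < \sum_(u <- s) u.
    rewrite -sum1_size natr_sum mulr_suml.
    case: s sn {sb sA sge IH} H => // a s _ H.
    rewrite !big_cons mul1r; apply: ltr_leD.
      by have := H a (mem_head _ _); rewrite /= ltNge.
    rewrite big_seq [leRHS]big_seq; apply: ler_sum => u us; rewrite ?mul1r ltW //.
    by have := H u; rewrite inE us orbT => /(_ isT); rewrite /= ltNge.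
  by rewrite sA ltxx.
have sp := perm_to_rem ls.
move: sn sb sA sge; rewrite (perm_size sp) !(perm_big _ sp) /=.
move: (rem l s) sp => t sp [tn] sb sA sge {ls}.
have {}sb : {in l :: t, forall u, 0 < u < 1}.
  by move=> u; rewrite -(perm_mem sp); apply: sb.
case: t tn sb sA sge {sp} => [|x0 t0].
  move=> _ _; rewrite !big_cons !big_nil /= addr0 mul1r => -> _.
  by rewrite mulr1 expr1.
set t := x0 :: t0 => tn sb sA sge.
(* Searching in [t], with [l] removed, makes [l] and [h] separate entries. If all of [t] were below
   [A], then l <= A would make the total too small. *)
have [h ht hA] : exists2 h, h \in t & A <= h.
  apply/hasP; apply: contraT; rewrite -all_predC => /allP H.
  have : \sum_(u <- t) u < (size t)%:R * A.
    rewrite -sum1_size natr_sum mulr_suml /t !big_cons mul1r; apply: ltr_leD.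
      by have := H x0 (mem_head _ _); rewrite /= ltNge.
    rewrite big_seq [leRHS]big_seq; apply: ler_sum => u us; rewrite ?mul1r ltW //.
    by have := H u; rewrite inE us orbT => /(_ isT); rewrite /= ltNge.
  have -> : (size t)%:R = (size (l :: t))%:R - 1 :> R.
    by rewrite -[size (l :: t)]/(size t).+1 -[(size t).+1]addn1 natrD addrK.
  rewrite mulrBl -sA big_cons mul1r => H'; exfalso.
  move: H' lA; move: (\sum_(_ <- _) _) => ? ? ?; lra.
clearbody t; clear x0 t0.
have tp := perm_to_rem ht.
move: tn sA sge; rewrite !big_cons (perm_size tp) !(perm_big _ tp) /= !big_cons.
move: (rem h t) tp => r tp [rn] sA sge {ht}.
have {}sb u : u \in [:: l, h & r] -> 0 < u < 1.
  by move=> ur; apply: sb; move: ur; rewrite !inE (perm_mem tp) inE.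
have [l0 l1] : 0 < l /\ l < 1 by apply/andP/sb; rewrite mem_head.
have [h0 h1] : 0 < h /\ h < 1 by apply/andP/sb; rewrite !inE eqxx orbT.
have rb : {in r, forall u, 0 < u < 1} by move=> u ur; apply: sb; rewrite !inE ur !orbT.
have rle : \sum_(u <- r) u <= (size r)%:R.
  by apply: sum_seq_le_size => u /rb /andP[].
(* The remaining entries contribute at most their number, two less than the full length. *)
have lh : 1 <= l + h by move: sge; rewrite -!natr1; lra.
have m01 : 0 < l + h - A < 1 by lra.
have Kr : 0 <= \prod_(u <- r) (u `^ (- beta) - 1).
  by rewrite big_seq; apply: prodr_ge0 => u ur; rewrite ltW // powRN_sub1_gt0 // rb.
rewrite mulrA exprS.
apply: le_trans (ler_wpM2r Kr (@powRN_sub1_pair_le R beta l A h be l0 _ h1 lh)) _.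
  by rewrite lA.
rewrite -mulrA ler_wpM2l //.
  by rewrite ltW // powRN_sub1_gt0 //; lra.
(* The lower bound on the sum survives because dropping [A] costs at most 1, as A <= h < 1. *)
have := IH ((l + h - A) :: r); rewrite /= !big_cons -rn; apply => //.
- by move=> u; rewrite inE => /predU1P[->//|/rb].
- by move: sA; rewrite -!natr1; move: (\sum_(_ <- _) _) => ?; lra.
- by move: sge; rewrite -!natr1; move: (\sum_(_ <- _) _) => ?; lra.
Qed.

(** * The upper bound *)

Lemma powR_invK (R : realType) (alpha y : R) :
  0 < alpha -> 0 < y -> (1 / y `^ alpha) `^ (- alpha^-1) = y.
Proof.
move=> a0 y0; rewrite div1r -powRN -powRrM mulrNN divff ?gt_eqF //.
by rewrite powRr1 // ltW.
Qed.

Lemma Falpha_le (R : realType) (n : nat) (alpha lambda : R) (x : 'rV[R]_n) :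
  (0 < n)%N -> 1 <= alpha -> 0 < lambda -> Hlambda n lambda x ->
  Falpha alpha x <= Num.max (n%:R - 1) (n%:R / ((1 + lambda) `^ alpha)).
Proof.
move=> n0 a1 la0 [xprod xpos].
have a0 : 0 < alpha by lra.
have nR0 : 0 < n%:R :> R by rewrite ltr0n.
rewrite le_max; case: leP => //= Sgt.
pose u i := 1 / (1 + x ord0 i) `^ alpha.
have up i : 0 < u i < 1.
  have xi := xpos i; have o : 1 `^ alpha = 1 :> R by rewrite powR1.
  have p0 : 0 < (1 + x ord0 i) `^ alpha by rewrite powR_gt0 //; lra.
  rewrite /u div1r invr_gt0 p0 /= invf_lt1 // -[ltLHS]o.
  by rewrite gt0_ltr_powR ?nnegrE //; lra.
have uK i : u i `^ (- alpha^-1) - 1 = x ord0 i.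
  by rewrite powR_invK //; [ring | have := xpos i; lra].
pose S := Falpha alpha x; pose A := S / n%:R.
have S0 : 0 < S.
  by have : 1 <= n%:R :> R; [rewrite ler1n | rewrite /S; lra].
have A0 : 0 < A by rewrite divr_gt0.
have : \prod_(v <- [seq u i | i <- enum 'I_n]) (v `^ (- alpha^-1) - 1) <=
    (A `^ (- alpha^-1) - 1) ^+ size [seq u i | i <- enum 'I_n].
  apply: prod_powRN_sub1_le.
  - by rewrite invr_gt0 a0 invf_le1.
  - by move=> v /mapP[i _ ->].
  - rewrite size_map size_enum_ord big_map big_enum /= -/S /A mulrC divfK //.
    by rewrite gt_eqF.
  - by rewrite size_map size_enum_ord big_map big_enum /= ltW.
rewrite size_map size_enum_ord big_map big_enum /= (eq_bigr _ (fun i _ => uK i)) xprod.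
have A1 : A < 1.
  rewrite /A ltr_pdivrMr // mul1r /S /Falpha -[ltRHS]mulr1 mulr_natl.
  rewrite -[n in ltRHS]card_ord -sumr_const; apply: ltr_sum => [|i _].
    by apply/hasP; exists (Ordinal n0) => //; rewrite mem_index_enum.
  by case/andP: (up i).
have KA : 0 < A `^ (- alpha^-1) - 1.
  by apply: powRN_sub1_gt0; rewrite ?invr_gt0 // A0.
(* Taking n-th roots leaves 1 + lambda <= A^(-1/alpha); raised to the power [alpha], this bounds (1
   + lambda)^alpha by 1/A = n/S. *)
rewrite ler_pXn2r ?nnegrE ?(ltW la0) ?(ltW KA) // => laK.
rewrite ler_pdivlMr ?powR_gt0 //; last lra.
have laA : (1 + lambda) `^ alpha <= A^-1.
  have -> : A^-1 = (A `^ (- alpha^-1)) `^ alpha.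
    by rewrite -powRrM mulNr mulVf ?gt_eqF // powR_inv1 // ltW.
  by rewrite ge0_ler_powR ?nnegrE ?powR_ge0 //; lra.
apply: le_trans (ler_wpM2l (ltW S0) laA) _.
by rewrite /A invf_div mulrC divfK // gt_eqF.
Qed.

(** * Points for the lower bound, and the supremum *)

Lemma Falpha_const (R : realType) (n : nat) (alpha lambda : R) :
  Falpha alpha (const_mx lambda : 'rV[R]_n) = n%:R / (1 + lambda) `^ alpha.
Proof.
rewrite /Falpha (eq_bigr (fun=> 1 / (1 + lambda) `^ alpha)) => [|i _].
  by rewrite sumr_const card_ord div1r mulr_natl.
by rewrite mxE.
Qed.

Lemma Hlambda_const (R : realType) (n : nat) (lambda : R) :
  0 < lambda -> Hlambda n lambda (const_mx lambda).
Proof.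
move=> la0; split=> [|i]; last by rewrite mxE.
under eq_bigr do rewrite mxE.
by rewrite prodr_const card_ord.
Qed.

Lemma exists_Falpha_ge (R : realType) (n : nat) (alpha lambda eta : R) :
  (0 < n)%N -> 0 < alpha -> 0 < lambda -> 0 < eta < 1 ->
  exists2 x : 'rV[R]_n, Hlambda n lambda x & (n%:R - 1) * (1 - eta) <= Falpha alpha x.
Proof.
case: n => // n _ a0 la0 /andP[eta0 eta1].
(* Chosen so that a coordinate [e] contributes exactly 1 - eta. *)
pose e := (1 - eta) `^ (- alpha^-1) - 1.
have e0 : 0 < e.
  by apply: powRN_sub1_gt0; rewrite ?invr_gt0 //; lra.
have eE : 1 / (1 + e) `^ alpha = 1 - eta.
  rewrite /e addrC subrK -powRrM mulNr mulVf ?gt_eqF // powR_inv1; last lra.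
  by rewrite div1r invrK.
(* The first coordinate restores the product constraint; its contribution is only used as
   nonnegative. *)
pose x : 'rV[R]_n.+1 := \row_i if i == ord0 then lambda ^+ n.+1 / e ^+ n else e.
have x0 i : 0 < x ord0 i.
  by rewrite mxE; case: ifP => _ //; rewrite divr_gt0 // exprn_gt0.
exists x.
- split => //; rewrite big_ord_recl mxE eqxx.
  under eq_bigr do rewrite mxE /=.
  by rewrite prodr_const card_ord divfK // gt_eqF // exprn_gt0.
- rewrite /Falpha big_ord_recl -natr1 addrK.
  rewrite (eq_bigr (fun=> 1 - eta)) => [|i _]; last by rewrite mxE /= eE.
  rewrite sumr_const card_ord mulr_natl lerDr divr_ge0 // powR_ge0 //.
Qed.

Theorem proposition4 (R : realType) (n : nat) (alpha lambda : R)
    (hn : (0 < n)%N) (halpha : 1 <= alpha) (hlambda : 0 < lambda) :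
  ereal_sup [set (Falpha alpha x)%:E | x in Hlambda n lambda] =
  (Num.max (n%:R - 1) (n%:R / ((1 + lambda) `^ alpha)))%:E.
Proof.
have alpha0 : 0 < alpha by lra.
have n0 : 0 < n%:R :> R by rewrite ltr0n.
apply/eqP; rewrite eq_le; apply/andP; split.
  apply: ge_ereal_sup => _ [x Hx <-].
  by rewrite lee_fin; apply: Falpha_le.
rewrite EFin_max ge_max; apply/andP; split; last first.
  apply: ereal_sup_ubound; exists (const_mx lambda); first exact: Hlambda_const.
  by rewrite Falpha_const.
apply/lee_addgt0Pr => e e0.
(* The cap 1/2 keeps eta < 1, and e/n keeps the total loss (n - 1) eta within [e]. *)
pose eta := Num.min (1 / 2) (e / n%:R).
have eta0 : 0 < eta by rewrite lt_min divr_gt0 // divr_gt0.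
have eta1 : eta <= 1 / 2 by rewrite ge_min lexx.
have etae : eta * n%:R <= e by rewrite -ler_pdivlMr // ge_min lexx orbT.
have [|x Hx Fx] := @exists_Falpha_ge R n alpha lambda eta hn alpha0 hlambda.
  by rewrite eta0; lra.
rewrite -leeBlDr //; apply: le_ereal_sup_tmp.
exists (Falpha alpha x)%:E; first by exists x.
by rewrite -EFinB lee_fin; nra.
Qed.
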